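(* Let $a>0$, $a_N=a\ln N/N$, and for $N\ge1$ let $P_{N,a_N}$ be the probability on sequences $(n_j)_{j\ge0}$ of nonnegative integers with $\sum_jn_j=N$ given by $P_{N,a_N}((n_j))\propto e^{-a_N\sum_j jn_j}$; write $\langle n_j\rangle_{N,a_N}$ for the expectation of $n_j$. Then: (i) For any $a>0$: $\lim_{N\to\infty}\frac1N\sum_{j<2/a_N}\langle n_j\rangle_{N,a_N}=1$ (complete generalized Bose–Einstein condensation). (ii) For $0<a<1$: $\lim_{N\to\infty}N^{-a}\langle n_i\rangle_{N,a_N}=1$ for every choice of $i=i(N)$ with $i=o\big(N^{1-a}/\ln^2N\big)$. (iii) For $a>1$: $\lim_{N\to\infty}N^{-1}\langle n_i\rangle_{N,a_N}=0$ for every $i\ge1$, but $\lim_{N\to\infty}N^{-\eta}\langle n_1\rangle_{N,a_N}=\infty$ for every $\eta<1$.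
   Context: This is the canonical ensemble of $N$ noninteracting bosons in a one-dimensional harmonic trap with scaled frequency $\omega\ln N/N$ at inverse temperature $\beta$, $a=\hbar\omega\beta$, $n_j$ being the occupation number of the $j$-th one-particle level. *)

(* Defs.v *)
From HB Require Import structures.
From mathcomp Require Import all_boot all_order all_algebra.
From mathcomp Require Import all_classical all_reals all_analysis.
Set Implicit Arguments. Unset Strict Implicit. Unset Printing Implicit Defensive.
Import Order.TTheory GRing.Theory Num.Theory.
Local Open Scope ring_scope.
Local Open Scope classical_set_scope.

(* A configuration of N bosons is the multiset of the one-particle levels
   occupied, encoded as a nondecreasing list of length N; the occupation
   number of level j is n_j = count_mem j s, and sum_j j n_j = sumn s. *)
Definition configs (N : nat) : set (seq nat) :=
  [set s | sorted leq s /\ size s = N].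

Definition weight {R : realType} (b : R) (s : seq nat) : R :=
  expR (- b * (sumn s)%:R).

Definition Zpart {R : realType} (b : R) (N : nat) : \bar R :=
  esum (configs N) (fun s => (weight b s)%:E).

Definition occ {R : realType} (b : R) (N j : nat) : R :=
  fine (esum (configs N) (fun s => ((count_mem j s)%:R * weight b s)%:E))
  / fine (Zpart b N).

Definition aN {R : realType} (a : R) (N : nat) : R := a * ln N%:R / N%:R.

(* Main.v *)
Require Import Defs.
From HB Require Import structures.
From mathcomp Require Import all_boot all_order all_algebra.
From mathcomp Require Import all_classical all_reals all_analysis.
From mathcomp Require Import ring lra.
Import Order.TTheory GRing.Theory Num.Theory numFieldNormedType.Exports.
Local Open Scope ring_scope.
Local Open Scope classical_set_scope.

(** Write [q = e^-b].  Shifting all levels by the lowest occupied one gives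
    [Z_(N+1) = Z_N / (1 - q^(N+1))], and removing one particle from level [j]
    gives [<n_j>_(N+1) = q^j (1 - q^(N+1)) (1 + <n_j>_N)].  Comparing this
    recurrence with one of constant ratio [x] bounds [<n_j>_N] above by
    [x / (1 - x)] for [x = q^j (1 - q^N)], and below, using only the last [M]
    steps, by [y / (1/M + 1 - y)] for [y <= q^j (1 - q^(N-M))].  With [b = a_N]
    one has [q^N = N^-a]; taking [M] of order [N^c] with [c < 1] keeps
    [q^(N-M)] equivalent to [N^-a], which yields (ii) and (iii).  For (i), the
    solved recurrence and a telescoping q-identity show that the levels
    [j >= 2/b] carry at most [1 / (1 - q) ~ N / (a ln N)] particles. *)

(** * Sums over arbitrary sets: scaling and the geometric series *)

(** Finite subsums give [<=] for every positive factor; using this for [c] and then for [c^-1] gives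
    equality. *)
Lemma esumZl (R : realType) (T : choiceType) (I : set T) (a : T -> \bar R)
    (c : R) : 0 < c -> (forall i, 0 <= a i)%E ->
  (\esum_(i in I) (c%:E * a i) = c%:E * \esum_(i in I) a i)%E.
Proof.
have le_esumZl (d : R) (f : T -> \bar R) : 0 < d -> (forall i, 0 <= f i)%E ->
    (\esum_(i in I) (d%:E * f i) <= d%:E * \esum_(i in I) f i)%E.
  move=> d0 f0; apply: ge_ereal_sup => /= _ [X [finX XI]] <-.
  rewrite -ge0_mule_fsumr//.
  apply: lee_wpmul2l; first by rewrite lee_fin ltW.
  by apply: esum_ge; exists X.
move=> c0 a0; apply/eqP; rewrite eq_le le_esumZl//=.
have ca0 i : (0 <= c%:E * a i)%E by rewrite mule_ge0// lee_fin ltW.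
rewrite -(@lee_pdivlMl _ c)// le_eqVlt; apply/orP; left.
have ic0 : 0 < c^-1 by rewrite invr_gt0.
rewrite eq_le; apply/andP; split; last first.
  by rewrite lee_pdivrMl// le_esumZl.
rewrite (eq_esum (b := fun i => (c^-1%:E * (c%:E * a i))%E)).
  exact: le_esumZl.
by move=> i _; rewrite muleA -EFinM mulVf ?gt_eqF// mul1e.
Qed.

Lemma esum_geometric (R : realType) (x : R) : 0 <= x -> x < 1 ->
  (\esum_(k in [set: nat]) (x ^+ k)%:E = ((1 - x)^-1)%:E)%E.
Proof.
move=> x0 x1; rewrite -nneseries_esumT => [|n]; last by rewrite lee_fin exprn_ge0.
have cx : series (geometric 1 x) @ \oo --> 1 * (1 - x)^-1.
  by apply: cvg_geometric_series; rewrite ger0_norm.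
rewrite mul1r in cx.
apply/cvg_lim => //.
have -> : (fun n => (\sum_(0 <= i < n) (x ^+ i)%:E)%E) =
    (fun n => (series (geometric 1 x) n)%:E).
  apply/funext => n; rewrite sumEFin /series/=; congr EFin.
  by apply: eq_bigr => i _; rewrite mul1r.
by apply: cvg_EFin => //; apply: nearW.
Qed.

(** * Bijections between configurations of N and N + 1 particles *)

Lemma weightE (R : realType) (b : R) s : weight b s = expR (- b) ^+ sumn s.
Proof. by rewrite /weight expRM_natr. Qed.

Lemma sumn_map_addn k s : sumn (map (addn k) s) = (k * size s + sumn s)%N.
Proof.
by elim: s => [|x s IH] /=; rewrite ?muln0// IH mulnS addnACA.
Qed.

(** A nonempty sorted list is given by its head, the lowest occupied level, and the differences of
    the other entries from that head. *)
Lemma bij_configs_shift N :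
  set_bij ([set: nat] `*`` (fun=> configs N)) (configs N.+1)
    (fun p => map (addn p.1) (0 :: p.2)%N).
Proof.
split.
- move=> [k s] [_ [/= so sz]]; split => /=; last by rewrite size_map sz.
  rewrite -[path _ _ _]/(sorted leq (map (addn k) (0 :: s)%N)).
  apply: (@homo_sorted _ _ _ leq) => [x y|]; first by rewrite leq_add2l.
  by rewrite /= path_min_sorted//; apply/allP.
- move=> [k s] [k' s'] _ _ /= [+ +]; rewrite !addn0 => <- h.
  by congr pair; apply: inj_map h; exact: addnI.
- move=> [|x t] [//= so [sz]].
  have xt := order_path_min leq_trans so.
  (* Truncated subtraction loses nothing here: the head [x] of a sorted list is its minimum. *)
  exists (x, map (subn^~ x) t) => /=.
    split=> //=; split; last by rewrite size_map.
    apply: (@homo_sorted _ _ _ leq) => [y z|]; first exact: leq_sub2r.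
    exact: path_sorted so.
  rewrite addn0; congr cons; rewrite -map_comp -[RHS]map_id.
  by apply/eq_in_map => y /(allP xt) /= xy; rewrite subnKC.
Qed.

(** Sorting restores the canonical list after a particle is put on level [j]; taking one copy of [j]
    out inverts this. *)
Lemma bij_configs_insert N (j : nat) :
  set_bij (configs N) (configs N.+1 `&` [set s : seq nat | j \in s])
    (fun s => sort leq (j :: s)).
Proof.
split.
- move=> s [so sz]; split; last by rewrite /= mem_sort mem_head.
  by split; rewrite ?size_sort /= ?sz// sort_sorted//; exact: leq_total.
- move=> s s'; rewrite !inE => -[so _] [so' _] h.
  apply: (sorted_eq leq_trans anti_leq) => //.
  by rewrite -(perm_cons j) -(perm_sort leq) h perm_sort.
- move=> s [[so sz] /= js]; exists (rem j s).
    split; first by apply: (subseq_sorted leq_trans (rem_subseq j s)).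
    by rewrite size_rem// sz.
  apply: (sorted_eq leq_trans anti_leq) => //.
    by apply: sort_sorted; exact: leq_total.
  by rewrite perm_sort perm_sym perm_to_rem.
Qed.

(** * Partition function and the recurrence for occupation numbers *)

Section partition_function.
Context {R : realType} (b : R).
Hypothesis b0 : 0 < b.
Local Notation q := (expR (- b)).

Lemma expRN_lt1 : q < 1. Proof. by rewrite expR_lt1 oppr_lt0. Qed.

Lemma expRN_exp_lt1 n : q ^+ n.+1 < 1.
Proof. by rewrite exprn_ilt1// ?expR_ge0// expRN_lt1. Qed.

Lemma expRN_exp_le1 n : q ^+ n <= 1.
Proof. by rewrite exprn_ile1 ?expR_ge0// ltW// expRN_lt1. Qed.

Lemma weight_ge0 s : (0 <= (weight b s)%:E)%E.
Proof. by rewrite lee_fin expR_ge0. Qed.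

Lemma Zpart0 : Zpart b 0 = 1%E.
Proof.
rewrite /Zpart (_ : configs 0 = [set [::]]).
  by rewrite esum_set1 ?weight_ge0// weightE/= expr0.
by apply/seteqP; split => [s [_ /size0nil ->]|s ->].
Qed.

Lemma ZpartS N (z : R) : 0 < z -> Zpart b N = z%:E ->
  Zpart b N.+1 = ((1 - q ^+ N.+1)^-1 * z)%:E.
Proof.
rewrite /Zpart => z0 Zz; rewrite (reindex_esum _ _ _ _ (bij_configs_shift N)).
rewrite -(@esum_esum _ _ _ setT (fun=> configs N)
  (fun k s => (weight b (map (addn k) (0 :: s)%N))%:E)); last first.
  by move=> *; exact: weight_ge0.
rewrite mulrC EFinM -(@esum_geometric _ (q ^+ N.+1)) ?expRN_exp_lt1//.
rewrite -esumZl//.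
apply: eq_esum => k _; rewrite -Zz muleC -esumZl ?exprn_gt0 ?expR_gt0//;
  last by move=> s; exact: weight_ge0.
apply: eq_esum => s [_ sz]; rewrite -EFinM !weightE sumn_map_addn/= sz.
by rewrite add0n exprD mulnC exprM.
Qed.

(** Finiteness makes [fine] in [occ] faithful, and positivity makes the division legitimate. *)
Lemma Zpart_fin N : exists2 z : R, 0 < z & Zpart b N = z%:E.
Proof.
elim: N => [|N [z z0 Zz]]; first by exists 1; rewrite ?Zpart0.
exists ((1 - q ^+ N.+1)^-1 * z); last exact: ZpartS.
by rewrite mulr_gt0// invr_gt0 subr_gt0 expRN_exp_lt1.
Qed.

Definition esum_count (N j : nat) : \bar R :=
  \esum_(s in configs N) ((count_mem j s)%:R * weight b s)%:E.

Lemma count_weight_ge0 j s : (0 <= ((count_mem j s)%:R * weight b s)%:E)%E.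
Proof. by rewrite lee_fin mulr_ge0// expR_ge0. Qed.

Lemma esum_count0 j : esum_count 0 j = 0%E.
Proof. by apply: esum1 => s [_ /size0nil ->]; rewrite mul0r. Qed.

Lemma esum_countS N j :
  (esum_count N.+1 j = (q ^+ j)%:E * (Zpart b N + esum_count N j))%E.
Proof.
rewrite /esum_count (esumID [set s : seq nat | j \in s]); last first.
  by move=> s _; exact: count_weight_ge0.
rewrite [X in (_ + X)%E]esum1 ?adde0; last first.
  by move=> s [_ /= /negP /count_memPn ->]; rewrite mul0r.
rewrite (reindex_esum _ _ _ _ (bij_configs_insert N j)).
rewrite /Zpart -esumD; [|by move=> *; exact: weight_ge0
                        |by move=> *; exact: count_weight_ge0].
rewrite -esumZl ?exprn_gt0 ?expR_gt0//; last first.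
  by move=> s; rewrite adde_ge0 ?weight_ge0 ?count_weight_ge0.
apply: eq_esum => s _; rewrite -EFinD -EFinM; congr EFin.
have p : perm_eq (sort leq (j :: s)) (j :: s) by rewrite perm_sort.
rewrite (permP p) !weightE (perm_sumn p)/= eqxx add1n exprD.
by rewrite -natr1 mulrDl mul1r mulrDr [_ * (_ * _)]mulrCA addrC.
Qed.

Lemma esum_count_fin N j : esum_count N j \is a fin_num.
Proof.
elim: N => [|N IH]; first by rewrite esum_count0.
have [z _ Zz] := Zpart_fin N.
by rewrite esum_countS Zz fin_numM// fin_numD IH.
Qed.

Lemma occ0 j : occ b 0 j = 0.
Proof. by rewrite /occ -/(esum_count 0 j) esum_count0 mul0r. Qed.

Lemma occS N j :
  occ b N.+1 j = q ^+ j * (1 - q ^+ N.+1) * (1 + occ b N j).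
Proof.
rewrite /occ -/(esum_count N.+1 j) -/(esum_count N j).
have [z z0 Zz] := Zpart_fin N.
have q1 : 1 - q ^+ N.+1 != 0 by rewrite subr_eq0 gt_eqF// expRN_exp_lt1.
rewrite esum_countS (ZpartS _ _ z0 Zz) Zz.
case: (esum_count N j) (esum_count_fin N j) => [r| |]//= _.
by field; rewrite q1 gt_eqF.
Qed.

Lemma occ_ge0 N j : 0 <= occ b N j.
Proof.
elim: N => [|N IH]; first by rewrite occ0.
have q1 : 0 <= 1 - q ^+ N.+1 by rewrite subr_ge0 expRN_exp_le1.
by rewrite occS !mulr_ge0 ?exprn_ge0 ?expR_ge0// addr_ge0.
Qed.

(** [x / (1 - x)] is the fixed point of [t |-> x * (1 + t)], and the ratios in [occS] increase with
    the particle number, so [x] dominates them all up to [N]. *)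
Lemma occ_le N j (x : R) : q ^+ j * (1 - q ^+ N) <= x -> x < 1 ->
  occ b N j <= x / (1 - x).
Proof.
move=> hx x1; have x1' : 0 < 1 - x by rewrite subr_gt0.
have : forall k, (k <= N)%N -> occ b k j <= x / (1 - x).
  have x0 : 0 <= x.
    apply: le_trans hx.
    by rewrite mulr_ge0 ?exprn_ge0 ?expR_ge0// subr_ge0 expRN_exp_le1.
  elim=> [_|k IH kN]; first by rewrite occ0 divr_ge0// ltW.
  have -> : x / (1 - x) = x * (1 + x / (1 - x)) by field; rewrite gt_eqF.
  rewrite occS ler_pM ?addr_ge0 ?occ_ge0//.
  - by rewrite mulr_ge0 ?exprn_ge0 ?expR_ge0// subr_ge0 expRN_exp_le1.
  - apply: le_trans hx; rewrite ler_wpM2l ?exprn_ge0 ?expR_ge0// lerD2l lerN2.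
    by rewrite ler_wiXn2l// ?expR_ge0// ltW// expRN_lt1.
  - by rewrite lerD2l IH// ltnW.
exact.
Qed.

(** From [0 <= occ b (N - M) j] on, each of the last [M] steps has ratio at least [y]. The bound is
    a rational minorant of [y + ... + y ^+ M]: a step turns [m] into [m.+1] in the numerator
    exactly, and enlarging the denominator only weakens it. *)
Lemma occ_ge N M j (y : R) : (M <= N)%N -> 0 <= y ->
  y <= q ^+ j * (1 - q ^+ (N - M)) ->
  y * M%:R / (1 + M%:R * (1 - y)) <= occ b N j.
Proof.
move=> MN y0 hy.
have y1 : y <= 1.
  apply: le_trans hy _; apply: mulr_ile1; rewrite ?exprn_ge0 ?expR_ge0//.
  - by rewrite subr_ge0 expRN_exp_le1.
  - exact: expRN_exp_le1.
have d0 m : 0 < 1 + m%:R * (1 - y).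
  by rewrite ltr_pwDl// mulr_ge0// subr_ge0.
have : forall m, (m <= M)%N ->
    y * m%:R / (1 + m%:R * (1 - y)) <= occ b (N - M + m) j.
  elim=> [_|m IH mM]; first by rewrite mulr0 mul0r occ_ge0.
  rewrite addnS occS.
  apply: (@le_trans _ _ (y * (1 + y * m%:R / (1 + m%:R * (1 - y))))).
    have -> : y * (1 + y * m%:R / (1 + m%:R * (1 - y))) =
        y * m.+1%:R / (1 + m%:R * (1 - y)).
      by rewrite -natr1; field; rewrite gt_eqF// d0.
    rewrite ler_wpM2l ?mulr_ge0// lef_pV2 ?posrE// ?d0// lerD2l.
    by rewrite ler_wpM2r ?subr_ge0// ler_nat.
  apply: ler_pM => //; last by rewrite lerD2l IH// ltnW.
    by rewrite addr_ge0// divr_ge0 ?mulr_ge0// ltW.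
  apply: le_trans hy _; rewrite ler_wpM2l ?exprn_ge0 ?expR_ge0//.
  rewrite lerD2l lerN2 ler_wiXn2l ?expR_ge0 ?ltW ?expRN_lt1//.
  by rewrite -addnS leq_addr.
by move=> /(_ M (leqnn _)); rewrite subnK.
Qed.

(** * Tail probabilities and the particle number in the low levels *)

(* The probability that at least [m] particles occupy level [j] is
   [q ^+ (j * m) * qfall N m]. *)
Definition qfall (N m : nat) : R := \prod_(k < m) (1 - q ^+ (N - k)).

Lemma qfall0 N : qfall N 0 = 1. Proof. by rewrite /qfall big_ord0. Qed.

Lemma qfallSS N m : qfall N.+1 m.+1 = (1 - q ^+ N.+1) * qfall N m.
Proof.
by rewrite /qfall big_ord_recl/= subn0; congr (_ * _); apply: eq_bigr.
Qed.

Lemma qfallS N m : qfall N m.+1 = qfall N m * (1 - q ^+ (N - m)).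
Proof. by rewrite /qfall big_ord_recr. Qed.

Lemma qfall_ge0 N m : 0 <= qfall N m.
Proof. by apply: prodr_ge0 => k _; rewrite subr_ge0 expRN_exp_le1. Qed.

Lemma qfall_le1 N m : qfall N m <= 1.
Proof.
rewrite /qfall; apply: prodr_ile1 => k _.
by rewrite subr_ge0 expRN_exp_le1 gerBl exprn_ge0// expR_ge0.
Qed.

(** Mean as a sum of tail probabilities: in [occS] the summand 1 yields the first tail, and
    [qfallSS] shifts the others. *)
Lemma occ_qfall N j :
  occ b N j = \sum_(m < N) q ^+ (j * m.+1) * qfall N m.+1.
Proof.
elim: N => [|N IH]; first by rewrite occ0 big_ord0.
rewrite occS IH big_ord_recl muln1 qfallSS qfall0 mulr1 mulrDr mulr1.
congr (_ + _); rewrite mulr_sumr; apply: eq_bigr => m _.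
rewrite /= /bump add1n qfallSS [in RHS]mulnS exprD.
by rewrite -!mulrA; congr (_ * _); rewrite !mulrA; congr (_ * _); rewrite mulrC.
Qed.

(** As [1 / (1 - q ^+ m.+1)] is the sum of [q ^+ (j * m.+1)] over all [j], this says that all levels
    together carry [N] particles. From [N] to [N.+1] the [m]-th term grows by
    [qfall N m * q ^+ (N - m)], which is [qfall N m - qfall N m.+1]. *)
Lemma sum_qfall N : \sum_(m < N) qfall N m.+1 / (1 - q ^+ m.+1) = N%:R.
Proof.
have q1 m : 1 - q ^+ m.+1 != 0 by rewrite subr_eq0 gt_eqF// expRN_exp_lt1.
have qfallNN n : qfall n n.+1 = 0 by rewrite qfallS subnn subrr mulr0.
elim: N => [|N IH]; first by rewrite big_ord0.
rewrite -natr1 -IH; apply/eqP; rewrite -subr_eq0 opprD addrA; apply/eqP.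
(* The added term [m = N] vanishes: [qfall N N.+1] has the factor [1 - q ^+ 0]. *)
have -> : \sum_(m < N) qfall N m.+1 / (1 - q ^+ m.+1) =
    \sum_(m < N.+1) qfall N m.+1 / (1 - q ^+ m.+1).
  by rewrite big_ord_recr/= qfallNN mul0r addr0.
rewrite -sumrB.
transitivity (\sum_(0 <= m < N.+1) (qfall N m - qfall N m.+1) - 1).
  rewrite big_mkord; congr (_ - _); apply: eq_bigr => m _.
  have qN : q ^+ N.+1 = q ^+ (N - m) * q ^+ m.+1.
    by rewrite -exprD addnS subnK// -ltnS.
  by rewrite qfallSS qfallS qN; field; exact: q1.
rewrite (telescope_sumr_eq (fun m => - qfall N m))//.
  by rewrite qfallNN qfall0 oppr0 opprK add0r subrr.
by move=> m _; rewrite opprK addrC.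
Qed.

(* The subtracted sum is the mean number of particles in the levels [j >= J]. *)
Lemma sum_occ_qfall N J : \sum_(j < J) occ b N j =
  N%:R - \sum_(m < N) q ^+ J ^+ m.+1 * (qfall N m.+1 / (1 - q ^+ m.+1)).
Proof.
have q1 m : 1 - q ^+ m.+1 != 0 by rewrite subr_eq0 gt_eqF// expRN_exp_lt1.
rewrite -[in N%:R]sum_qfall -sumrB.
under eq_bigr do rewrite occ_qfall.
rewrite exchange_big; apply: eq_bigr => m _ /=.
rewrite -mulr_suml; under eq_bigr do rewrite mulnC exprM.
have h : q ^+ J ^+ m.+1 - 1 = (q ^+ m.+1 - 1) * \sum_(i < J) q ^+ m.+1 ^+ i.
  by rewrite -subrX1 exprAC.
have -> : \sum_(i < J) (q ^+ m.+1) ^+ i =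
    (1 - q ^+ J ^+ m.+1) / (1 - q ^+ m.+1).
  apply: (mulIf (q1 m)); by rewrite divfK// mulrC -[RHS]opprB h -mulNr opprB.
by field; exact: q1.
Qed.

Lemma sum_occ_le N J : \sum_(j < J) occ b N j <= N%:R.
Proof.
rewrite sum_occ_qfall gerBl sumr_ge0// => m _.
rewrite mulr_ge0 ?exprn_ge0 ?expR_ge0// divr_ge0 ?qfall_ge0//.
by rewrite subr_ge0 expRN_exp_le1.
Qed.

(** In the subtracted sum the powers of [q ^+ J] are dominated by those of [2^-1], whose sum is
    below 1, and each remaining factor by [(1 - q)^-1]. *)
Lemma sum_occ_ge N J : q ^+ J <= 2^-1 ->
  N%:R - (1 - q)^-1 <= \sum_(j < J) occ b N j.
Proof.
move=> qJ; rewrite sum_occ_qfall lerD2l lerN2.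
have q1 : 0 < 1 - q by rewrite subr_gt0 expRN_lt1.
apply: (@le_trans _ _ (\sum_(m < N) (2^-1 ^+ m.+1) * (1 - q)^-1)).
  apply: ler_sum => m _; rewrite ler_pM ?exprn_ge0 ?expR_ge0//.
  - by rewrite divr_ge0 ?qfall_ge0// subr_ge0 expRN_exp_le1.
  - by rewrite lerXn2r ?nnegrE ?exprn_ge0 ?expR_ge0.
  - rewrite -[leRHS]mul1r ler_pM ?qfall_ge0 ?qfall_le1//.
      by rewrite invr_ge0 subr_ge0 expRN_exp_le1.
    rewrite lef_pV2 ?posrE ?subr_gt0 ?expRN_exp_lt1 ?expRN_lt1//.
    rewrite lerD2l lerN2 -[leRHS]expr1 ler_wiXn2l ?expR_ge0//.
    by rewrite ltW// expRN_lt1.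
rewrite -mulr_suml ler_piMl ?invr_ge0 ?(ltW q1)//.
have -> : \sum_(m < N) (2^-1 : R) ^+ m.+1 = 1 - 2^-1 ^+ N.
  elim: (N) => [|n IH]; first by rewrite big_ord0 expr0 subrr.
  by rewrite big_ord_recr/= IH [in RHS]exprS exprS; field.
by rewrite gerBl exprn_ge0.
Qed.

End partition_function.

(** * Elementary limits for logarithms, powers and [aN] *)

Section asymptotics.
Context {R : realType}.

Lemma cvg_ln_nat : (fun N : nat => ln (N%:R : R)) @ \oo --> +oo.
Proof.
apply/cvgryPge => A; near=> N.
have AN : expR A <= N%:R by near: N; exact: nbhs_infty_ger.
by rewrite -(expRK A) ler_ln ?posrE ?expR_gt0// (lt_le_trans (expR_gt0 A)).
Unshelve. all: by end_near. Qed.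

Lemma cvg_nat_powRN (s : R) : 0 < s ->
  (fun N : nat => (N%:R : R) `^ (- s)) @ \oo --> 0.
Proof.
move=> s0.
have h : (fun N : nat => s * ln (N%:R : R)) @ \oo --> +oo.
  apply/cvgryPge => A; near=> N; rewrite -ler_pdivrMl//.
  by near: N; apply: cvgry_ge; exact: cvg_ln_nat.
apply: cvg_trans (cvg_comp _ _ h (@cvgr_expR R)).
apply: near_eq_cvg; near=> N.
have N0 : (N%:R : R) != 0 by rewrite pnatr_eq0 -lt0n; near: N; exact: nbhs_infty_gt.
by rewrite /= /powR (negbTE N0) mulNr.
Unshelve. all: by end_near. Qed.

(** Half of the negative power absorbs the logarithm: ln x < x at x = N^(s/2) bounds ln N by (2/s)
    N^(s/2). *)
Lemma cvg_ln_powRN (s : R) : 0 < s ->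
  (fun N : nat => ln (N%:R : R) * N%:R `^ (- s)) @ \oo --> 0.
Proof.
move=> s0; have s20 : 0 < s / 2 by rewrite divr_gt0.
apply: (@squeeze_cvgr _ _ _ _ (fun=> 0)
    (fun N : nat => 2 / s * N%:R `^ (- (s / 2)))).
- near=> N.
  have N1 : 1 <= N%:R :> R by rewrite ler1n; near: N; exact: nbhs_infty_gt.
  have N0 : 0 < N%:R :> R by rewrite (lt_le_trans _ N1).
  rewrite mulr_ge0 ?ln_ge0 ?powR_ge0//=.
  have -> : - s = - (s / 2) + - (s / 2) by field.
  rewrite powRD ?(gt_eqF N0) ?implybT// mulrA.
  rewrite ler_wpM2r ?powR_ge0//.
  rewrite powRN ler_pdivrMr ?powR_gt0// -ler_pdivrMl ?divr_gt0//.
  rewrite invf_div -ln_powR ltW// ln_sublinear// powR_gt0//.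
- exact: cvg_cst.
- by rewrite -[X in _ --> X](mulr0 (2 / s)); apply: cvgMr; exact: cvg_nat_powRN.
Unshelve. all: by end_near. Qed.

Lemma aNE (a : R) N : aN a N = a * (ln (N%:R : R) * N%:R `^ (- 1)).
Proof. by rewrite /aN powR_inv1// mulrA. Qed.

Lemma cvg_aN (a : R) : aN a @ \oo --> 0.
Proof.
rewrite (_ : aN a = fun N => a * (ln (N%:R : R) * N%:R `^ (- 1))); last first.
  by apply/funext => N; rewrite aNE.
by rewrite -[X in _ --> X](mulr0 a); apply: cvgMr; exact: cvg_ln_powRN.
Qed.

Lemma aN_gt0 (a : R) N : 0 < a -> (1 < N)%N -> 0 < aN a N.
Proof.
move=> a0 N1; rewrite /aN divr_gt0 ?mulr_gt0 ?ln_gt0 ?ltr1n//.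
by rewrite ltr0n ltnW.
Qed.

Lemma expRN_aN_exp (a : R) N : (1 < N)%N -> expR (- aN a N) ^+ N = N%:R `^ (- a).
Proof.
move=> N1; have N0 : N%:R != 0 :> R by rewrite pnatr_eq0 -lt0n ltnW.
by rewrite -expRM_natr /powR (negbTE N0) /aN mulNr divfK// mulNr.
Qed.

Lemma inv1B_expRN_le (b : R) : 0 < b -> (1 - expR (- b))^-1 <= 1 + b^-1.
Proof.
move=> b0.
have b1 : 0 < 1 + b by rewrite addr_gt0.
have h : b / (1 + b) <= 1 - expR (- b).
  rewrite lerBrDl -lerBrDr (_ : 1 - b / (1 + b) = (1 + b)^-1).
    by rewrite expRN lef_pV2 ?posrE ?expR_gt0 ?expR_ge1Dx.
  by field; rewrite gt_eqF.
have h0 : 0 < b / (1 + b) by rewrite divr_gt0.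
rewrite (_ : 1 + b^-1 = (b / (1 + b))^-1); last by field; rewrite !gt_eqF.
by rewrite lef_pV2 ?posrE// (lt_le_trans h0).
Qed.

Lemma cvg_inv_ln (a : R) : 0 < a ->
  (fun N : nat => N%:R^-1 + (a * ln (N%:R : R))^-1) @ \oo --> 0.
Proof.
move=> a0; rewrite -[X in _ --> X](addr0 0); apply: cvgD.
  have := @cvg_nat_powRN 1 ltr01.
  by under eq_fun do rewrite powR_inv1//.
have h : (fun N : nat => a * ln (N%:R : R)) @ \oo --> +oo.
  apply/cvgryPge => A; near=> N; rewrite -ler_pdivrMl//.
  by near: N; apply: cvgry_ge; exact: cvg_ln_nat.
apply/gtr0_cvgV0; last exact: h.
by apply: cvgry_gt.
Unshelve. all: by end_near. Qed.

Lemma inv1B_aN_le (a : R) N : 0 < a -> (1 < N)%N ->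
  N%:R^-1 * (1 - expR (- aN a N))^-1 <= N%:R^-1 + (a * ln (N%:R : R))^-1.
Proof.
move=> a0 N1; have N0 : 0 < N%:R :> R by rewrite ltr0n ltnW.
have l0 : 0 < ln (N%:R : R) by rewrite ln_gt0// ltr1n.
have b0 := aN_gt0 _ _ a0 N1.
apply: (@le_trans _ _ (N%:R^-1 * (1 + (aN a N)^-1))).
  by rewrite ler_wpM2l ?invr_ge0 ?inv1B_expRN_le.
by rewrite /aN le_eqVlt; apply/orP; left; apply/eqP; field; rewrite !gt_eqF.
Qed.

(** * Complete condensation in the levels below 2 / a_N *)

Lemma cvg_sum_occ (a : R) : 0 < a ->
  (fun N : nat => N%:R^-1 *
      \sum_(j < (Num.truncn (2 / aN a N)).+1 | j%:R < 2 / aN a N) occ (aN a N) N j)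
     @ \oo --> (1 : R).
Proof.
move=> a0.
apply: (@squeeze_cvgr _ _ _ _
  (fun N : nat => 1 - (N%:R^-1 + (a * ln (N%:R : R))^-1)) (fun=> 1)); last 2 first.
- rewrite -[X in _ --> X]subr0; apply: cvgB; first exact: cvg_cst.
  exact: cvg_inv_ln.
- exact: cvg_cst.
near=> N.
have N1 : (1 < N)%N by near: N; exact: nbhs_infty_gt.
have N0 : 0 < N%:R :> R by rewrite ltr0n ltnW.
have b0 := aN_gt0 _ _ a0 N1.
have b1 : aN a N <= 1.
  by near: N; apply: (cvgr_le 0); [exact: cvg_aN|exact: ltr01].
set b := aN a N in b0 b1 *; set J := Num.truncn (2 / b).
have J2 : J%:R <= 2 / b by rewrite truncn_le// divr_ge0// ltW.
have J2' : 2 / b < J%:R + 1 by rewrite natr1 truncnS_gt.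
apply/andP; split; last first.
  rewrite ler_pdivrMl// mulr1; apply: le_trans (sum_occ_le b b0 N J.+1).
  rewrite [leRHS](bigID (fun j : 'I_J.+1 => j%:R < 2 / b))/= lerDl.
  by apply: sumr_ge0 => j _; exact: occ_ge0.
apply: (@le_trans _ _ (N%:R^-1 * (N%:R - (1 - expR (- b))^-1))).
  by rewrite mulrBr mulVf ?gt_eqF// lerD2l lerN2 inv1B_aN_le.
rewrite ler_wpM2l ?invr_ge0//.
apply: (@le_trans _ _ (\sum_(j < J) occ b N j)).
  apply: sum_occ_ge => //.
  (* This follows from b (J + 1) > 2 and b <= 1; then e^(bJ) >= 1 + bJ >= 2, so q^J <= 1/2. *)
  have h : 1 <= b * J%:R.
    move: J2'; rewrite ltr_pdivrMr// => J2'; lra.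
  rewrite -expRM_natr mulNr expRN lef_pV2 ?posrE ?expR_gt0//.
  by apply: le_trans (expR_ge1Dx _); lra.
(* All [j < J] satisfy [j < 2 / b]; level [J] does so unless [2 / b] is an integer, and its term is
   nonnegative. *)
rewrite [leRHS]big_mkcond big_ord_recr/= -[leLHS]addr0 lerD//; last first.
  by case: ifP => // _; exact: occ_ge0.
apply: ler_sum => j _; rewrite ifT//.
by apply: lt_le_trans J2; rewrite ltr_nat.
Unshelve. all: by end_near. Qed.

(** * Bounds for the occupation of a single level *)

Lemma truncn_ge_half (x : R) : 1 <= x -> x / 2 <= (Num.truncn x)%:R.
Proof.
move=> x1; have := truncnS_gt x; rewrite -natr1.
have : 1 <= (Num.truncn x)%:R :> R by rewrite ler1n truncn_gt0.
lra.
Qed.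

(* [1 - occ_defect a c i N] bounds from below the ratio of the tails
   [P (n_i >= m+1) / P (n_i >= m)] for all [m < N `^ c]. *)
Definition occ_defect (a c : R) (i N : nat) : R :=
  i%:R * aN a N +
  N%:R `^ (- a) * expR (a * (ln (N%:R : R) * N%:R `^ (- (1 - c)))).

(** This is [occ_ge] with [y = 1 - d] and M the integer part of N^c, after division by M; 1/M <=
    2/N^c accounts for the 2. The exponent [p] is the normalisation: [a] in (ii), [eta] in (iii). *)
Lemma occ_powR_ge (a c p : R) (i N : nat) : 0 < a -> 0 < c -> c < 1 ->
  (1 < N)%N -> occ_defect a c i N <= 1 ->
  (1 - occ_defect a c i N) /
    (2 * N%:R `^ (p - c) + N%:R `^ p * occ_defect a c i N) <=
  (N%:R `^ p)^-1 * occ (aN a N) N i.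
Proof.
move=> a0 c0 c1 N1; set d := occ_defect a c i N => d1.
have N0 : 0 < N%:R :> R by rewrite ltr0n ltnW.
have N1' : 1 <= N%:R :> R by rewrite ler1n ltnW.
have b0 := aN_gt0 _ _ a0 N1.
have l0 : 0 < ln (N%:R : R) by rewrite ln_gt0// ltr1n.
pose M := Num.truncn ((N%:R : R) `^ c).
have Nc1 : 1 <= (N%:R : R) `^ c by rewrite -[leLHS](powRr0 N%:R) ler_powR// ltW.
have Mc : M%:R <= (N%:R : R) `^ c by rewrite truncn_le// powR_ge0.
have Mc2 := truncn_ge_half _ Nc1; rewrite -/M in Mc2.
have M0 : 0 < M%:R :> R by lra.
have MN : (M <= N)%N.
  by rewrite -(ler_nat R) (le_trans Mc)// ler1_powR// ltW.
have d0 : 0 < d.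
  apply: ltr_wpDl; first by rewrite mulr_ge0// ltW.
  by rewrite mulr_gt0 ?powR_gt0 ?expR_gt0.
have h : (1 - d) * M%:R / (1 + M%:R * (1 - (1 - d))) <= occ (aN a N) N i.
  apply: occ_ge => //; first by rewrite subr_ge0.
  have qi : 1 - i%:R * aN a N <= expR (- aN a N) ^+ i.
    by rewrite -expRM_natr mulNr mulrC; exact: expR_ge1Dx.
  have qi1 := expRN_exp_le1 _ b0 i.
  (* q^(N-M) = N^-a e^(M a_N), and M a_N <= a ln N / N^(1-c). *)
  have qNM : expR (- aN a N) ^+ (N - M) <=
      N%:R `^ (- a) * expR (a * (ln (N%:R : R) * N%:R `^ (- (1 - c)))).
    rewrite -expRM_natr natrB// mulrBr expRD expRM_natr expRN_aN_exp//.
    rewrite ler_wpM2l ?powR_ge0// ler_expR mulNr opprK /aN -!mulrA.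
    rewrite ler_wpM2l ?(ltW a0)// ler_wpM2l ?(ltW l0)//.
    rewrite opprB powRB ?(gt_eqF N0) ?implybT// powRr1 ?(ltW N0)// mulrC.
    by rewrite ler_wpM2r ?invr_ge0.
  have qNM0 := exprn_ge0 (N - M) (expR_ge0 (- aN a N)).
  (* With 1 - u <= x <= 1 and 0 <= y <= v, one has x (1 - y) >= x - y >= 1 - u - v. *)
  move: qi qi1 qNM qNM0; rewrite /d /occ_defect.
  move: (expR (- aN a N) ^+ i) (expR (- aN a N) ^+ (N - M)) => x y.
  move: (_ * aN a N) (_ `^ _ * expR _) => u v; nra.
have Np : 0 < (N%:R : R) `^ p by rewrite powR_gt0.
have den : 0 < M%:R^-1 + d by rewrite addr_gt0 ?invr_gt0.
rewrite [leRHS]mulrC ler_pdivlMr//; apply: le_trans h.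
rewrite subKr.
have -> : (1 - d) * M%:R / (1 + M%:R * d) = (1 - d) / (M%:R^-1 + d).
  by field; rewrite !gt_eqF// ?addr_gt0 ?mulr_gt0.
have -> : 2 * N%:R `^ (p - c) + N%:R `^ p * d =
    (2 / N%:R `^ c + d) * N%:R `^ p :> R.
  by rewrite powRB ?(gt_eqF N0) ?implybT//; field; rewrite gt_eqF// powR_gt0.
have cp : 0 < 2 / (N%:R : R) `^ c by rewrite divr_gt0// powR_gt0.
rewrite invfM mulrA divfK ?gt_eqF// ler_wpM2l ?subr_ge0//.
rewrite lef_pV2 ?posrE ?(addr_gt0 cp)// lerD2r.
by rewrite -invf_div lef_pV2 ?posrE// divr_gt0// powR_gt0.
Qed.

Lemma cvg_expR_aN (a c : R) : c < 1 ->
  (fun N : nat => expR (a * (ln (N%:R : R) * N%:R `^ (- (1 - c))))) @ \oo --> (1 : R).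
Proof.
move=> c1; rewrite -[X in _ --> X]expR0.
apply: continuous_cvg; first exact: continuous_expR.
rewrite -[X in _ --> X](mulr0 a); apply: cvgMr.
by apply: cvg_ln_powRN; rewrite subr_gt0.
Qed.

(** At every level the ratio q^i (1 - q^N) is at most x = 1 - N^-a, whose fixed point x / (1 - x) is
    N^a - 1. *)
Lemma occ_powR_le1 (a : R) (i N : nat) : 0 < a -> (1 < N)%N ->
  (N%:R `^ a)^-1 * occ (aN a N) N i <= 1.
Proof.
move=> a0 N1; have N0 : 0 < N%:R :> R by rewrite ltr0n ltnW.
have b0 := aN_gt0 _ _ a0 N1.
have Na0 : 0 < (N%:R : R) `^ a by rewrite powR_gt0.
rewrite ler_pdivrMl// mulr1.
set x := 1 - N%:R `^ (- a); have x1 : x < 1 by rewrite gtrBl powR_gt0.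
have h : occ (aN a N) N i <= x / (1 - x).
  apply: occ_le => //; rewrite expRN_aN_exp//.
  rewrite ler_piMl ?expRN_exp_le1// -expRN_aN_exp// subr_ge0.
  exact: expRN_exp_le1.
apply: (le_trans h); rewrite subKr powRN invrK.
by rewrite ler_piMl ?(ltW Na0)// ltW.
Qed.

(** * Limits for single levels *)

(** N^a times the defect tends to 1, so the lower bound of [occ_powR_ge] with [p = a] tends to 1 and
    meets [occ_powR_le1]. *)
Lemma cvg_occ_powR (a : R) (i : nat -> nat) : 0 < a -> a < 1 ->
  (fun N : nat => (i N)%:R / ((N%:R `^ (1 - a)) / (ln N%:R) ^+ 2)) @ \oo --> (0 : R) ->
  (fun N : nat => (N%:R `^ a)^-1 * occ (aN a N) N (i N)) @ \oo --> (1 : R).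
Proof.
(* Any c strictly between a and 1 serves: c > a makes N^(a-c) vanish, c < 1 makes the exponential
   factor tend to 1. *)
move=> a0 a1 hi; pose c := (1 + a) / 2.
have c0 : 0 < c by rewrite /c; lra.
have c1 : c < 1 by rewrite /c; lra.
have ac : 0 < c - a by rewrite /c; lra.
have inv_ln : (fun N : nat => (ln (N%:R : R))^-1) @ \oo --> (0 : R).
  by apply/gtr0_cvgV0; [apply: cvgry_gt|]; exact: cvg_ln_nat.
(* This quantity is a times the ratio in [hi] divided by ln N. *)
have hib : (fun N : nat => N%:R `^ a * ((i N)%:R * aN a N)) @ \oo --> (0 : R).
  have h : (fun N : nat => a * ((i N)%:R / ((N%:R `^ (1 - a)) / (ln N%:R) ^+ 2)
      * (ln (N%:R : R))^-1)) @ \oo --> (0 : R).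
    rewrite -[X in _ --> X](mulr0 a); apply: cvgMr.
    by rewrite -[X in _ --> X](mulr0 0); exact: cvgM.
  apply: cvg_trans h; apply: near_eq_cvg; near=> N.
  have N1 : (1 < N)%N by near: N; exact: nbhs_infty_gt.
  have N0 : 0 < N%:R :> R by rewrite ltr0n ltnW.
  have l0 : 0 < ln (N%:R : R) by rewrite ln_gt0// ltr1n.
  rewrite /aN powRB ?(gt_eqF N0) ?implybT// powRr1 ?(ltW N0)//.
  by field; rewrite !gt_eqF// powR_gt0.
have hd' : (fun N : nat => N%:R `^ a * occ_defect a c (i N) N) @ \oo --> (1 : R).
  have h : (fun N : nat => N%:R `^ a * ((i N)%:R * aN a N) +
      expR (a * (ln (N%:R : R) * N%:R `^ (- (1 - c))))) @ \oo --> (1 : R).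
    by rewrite -[X in _ --> X](add0r 1); apply: cvgD => //; exact: cvg_expR_aN.
  apply: cvg_trans h; apply: near_eq_cvg; near=> N.
  have N0 : 0 < N%:R :> R by rewrite ltr0n; near: N; exact: nbhs_infty_gt.
  rewrite /occ_defect mulrDr; congr (_ + _).
  by rewrite [RHS]mulrA powRN mulfV ?mul1r// gt_eqF// powR_gt0.
have hd : (fun N : nat => occ_defect a c (i N) N) @ \oo --> (0 : R).
  have h : (fun N : nat => N%:R `^ (- a) * (N%:R `^ a * occ_defect a c (i N) N))
      @ \oo --> (0 : R).
    by rewrite -[X in _ --> X](mul0r 1); apply: cvgM => //; exact: cvg_nat_powRN.
  apply: cvg_trans h; apply: near_eq_cvg; near=> N.
  have N0 : 0 < N%:R :> R by rewrite ltr0n; near: N; exact: nbhs_infty_gt.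
  by rewrite mulrA powRN mulVf ?mul1r// gt_eqF// powR_gt0.
apply: (@squeeze_cvgr _ _ _ _ (fun N => (1 - occ_defect a c (i N) N) /
    (2 * N%:R `^ (a - c) + N%:R `^ a * occ_defect a c (i N) N)) (fun=> 1)).
- near=> N.
  have N1 : (1 < N)%N by near: N; exact: nbhs_infty_gt.
  rewrite occ_powR_le1// andbT occ_powR_ge//.
  by near: N; apply: (cvgr_le 0).
- rewrite -[X in _ --> X](mulr1 1) -[X in _ * X]invr1; apply: cvgM.
    by rewrite -[X in _ --> X]subr0; apply: cvgB => //; exact: cvg_cst.
  apply: cvgV; first exact: oner_neq0.
  rewrite -[X in _ --> X](add0r 1); apply: cvgD => //.
  rewrite -[X in _ --> X](mulr0 2); apply: cvgMr.
  by rewrite -opprB; exact: cvg_nat_powRN.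
- exact: cvg_cst.
Unshelve. all: by end_near. Qed.

(** For [i >= 1], q^i <= q, so the occupation is at most q / (1 - q), of order N / ln N. *)
Lemma cvg_occ_pos_level (a : R) (i : nat) : 0 < a -> (1 <= i)%N ->
  (fun N : nat => N%:R^-1 * occ (aN a N) N i) @ \oo --> (0 : R).
Proof.
move=> a0 i1; apply: (@squeeze_cvgr _ _ _ _ (fun=> 0)
  (fun N : nat => N%:R^-1 + (a * ln (N%:R : R))^-1)); last 2 first.
- exact: cvg_cst.
- exact: cvg_inv_ln.
near=> N.
have N1 : (1 < N)%N by near: N; exact: nbhs_infty_gt.
have b0 := aN_gt0 _ _ a0 N1.
have q1 := expRN_lt1 _ b0.
rewrite mulr_ge0 ?invr_ge0 ?occ_ge0//=.
apply: le_trans (inv1B_aN_le _ _ a0 N1); rewrite ler_wpM2l ?invr_ge0//.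
apply: (@le_trans _ _ (expR (- aN a N) / (1 - expR (- aN a N)))).
  apply: occ_le => //; rewrite -[leRHS]mulr1.
  apply: ler_pM; rewrite ?exprn_ge0 ?expR_ge0//.
  - by rewrite subr_ge0 expRN_exp_le1.
  - by rewrite -[leRHS]expr1 ler_wiXn2l ?expR_ge0 ?(ltW q1).
by rewrite ler_piMl ?invr_ge0 ?subr_ge0 ?(ltW q1).
Unshelve. all: by end_near. Qed.

(** Since [eta < 1 < a], N^eta times the defect tends to 0: in [occ_powR_ge] with [p = eta] the
    denominator tends to 0, the numerator to 1. *)
Lemma cvg_occ1_powR (a eta : R) : 1 < a -> eta < 1 ->
  (fun N : nat => (N%:R `^ eta)^-1 * occ (aN a N) N 1) @ \oo --> +oo.
Proof.
move=> a1 e1; have a0 : 0 < a by rewrite (lt_trans _ a1).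
(* The midpoint of max(eta, 0) and 1, so that 0 < c < 1 and N^(eta-c) tends to 0. *)
pose c := (Num.max eta 0 + 1) / 2.
have [c0 c1 ec] : [/\ 0 < c, c < 1 & 0 < c - eta].
  by rewrite /c; case: (lerP eta 0) => h; split; lra.
have N_gt0 : \forall N \near \oo, 0 < N%:R :> R.
  by near=> N; rewrite ltr0n; near: N; exact: nbhs_infty_gt.
have hd : (fun N : nat => occ_defect a c 1 N) @ \oo --> (0 : R).
  rewrite -[X in _ --> X](addr0 0); apply: cvgD.
    by under eq_fun do rewrite mul1r; exact: cvg_aN.
  rewrite -[X in _ --> X](mul0r 1); apply: cvgM; first exact: cvg_nat_powRN.
  exact: cvg_expR_aN.
have hd' : (fun N : nat => N%:R `^ eta * occ_defect a c 1 N) @ \oo --> (0 : R).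
  have h : (fun N : nat => a * (ln (N%:R : R) * N%:R `^ (- (1 - eta))) +
      N%:R `^ (- (a - eta)) *
      expR (a * (ln (N%:R : R) * N%:R `^ (- (1 - c))))) @ \oo --> (0 : R).
    rewrite -[X in _ --> X](addr0 0); apply: cvgD.
      rewrite -[X in _ --> X](mulr0 a); apply: cvgMr.
      by apply: cvg_ln_powRN; rewrite subr_gt0.
    rewrite -[X in _ --> X](mul0r 1); apply: cvgM; last exact: cvg_expR_aN.
    by apply: cvg_nat_powRN; lra.
  apply: cvg_trans h; apply: near_eq_cvg; near=> N.
  have N0 : 0 < N%:R :> R by near: N.
  rewrite /occ_defect mulrDr mul1r aNE !opprB !powRD ?(gt_eqF N0) ?implybT//.
  by rewrite !powRN mulrA; congr (_ + _); ring.
have hden : (fun N : nat => 2 * N%:R `^ (eta - c) +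
    N%:R `^ eta * occ_defect a c 1 N) @ \oo --> (0 : R).
  rewrite -[X in _ --> X](addr0 0); apply: cvgD => //.
  rewrite -[X in _ --> X](mulr0 2); apply: cvgMr.
  by rewrite -opprB; exact: cvg_nat_powRN.
(* The threshold is made positive so that a numerator >= 1/2 over a denominator <= 1/(2A) gives at
   least A. *)
apply/cvgryPge => A0; pose A := Num.max A0 1.
have A1 : 0 < A by rewrite lt_max ltr01 orbT.
near=> N; apply: (@le_trans _ _ A); first by rewrite le_max lexx.
have N1 : (1 < N)%N by near: N; exact: nbhs_infty_gt.
have N0 : 0 < N%:R :> R by near: N.
have b0 := aN_gt0 _ _ a0 N1.
have d12 : occ_defect a c 1 N <= 2^-1 by near: N; apply: (cvgr_le 0).
have denA : 2 * N%:R `^ (eta - c) + N%:R `^ eta * occ_defect a c 1 N <= (2 * A)^-1.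
  by near: N; apply: (cvgr_le 0) => //; rewrite invr_gt0 mulr_gt0.
have den0 : 0 < 2 * N%:R `^ (eta - c) + N%:R `^ eta * occ_defect a c 1 N.
  apply: ltr_pwDl; first by rewrite mulr_gt0 ?powR_gt0.
  apply: mulr_ge0; first exact: powR_ge0.
  by rewrite addr_ge0// ?mul1r ?(ltW b0)// mulr_ge0 ?powR_ge0 ?expR_ge0.
have d1 : occ_defect a c 1 N <= 1 by lra.
apply: le_trans (occ_powR_ge a c eta 1 N a0 c0 c1 N1 d1).
rewrite ler_pdivlMr//; apply: (@le_trans _ _ (A * (2 * A)^-1)).
  by rewrite ler_wpM2l// ltW.
by rewrite invfM mulrCA mulfV ?gt_eqF// mulr1; lra.
Unshelve. all: by end_near. Qed.

End asymptotics.

Theorem theorem4 (R : realType) (a : R) (ha : 0 < a) :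
  (* (i) complete generalized BEC *)
  ((fun N : nat => N%:R^-1 *
      \sum_(j < (Num.truncn (2 / aN a N)).+1 | j%:R < 2 / aN a N) occ (aN a N) N j)
     @ \oo --> (1 : R)) /\
  (* (ii) *)
  (a < 1 -> forall i : nat -> nat,
     (fun N : nat => (i N)%:R / ((N%:R `^ (1 - a)) / (ln N%:R) ^+ 2)) @ \oo --> (0 : R) ->
     (fun N : nat => (N%:R `^ a)^-1 * occ (aN a N) N (i N)) @ \oo --> (1 : R)) /\
  (* (iii) *)
  (1 < a ->
     (forall i : nat, (1 <= i)%N ->
        (fun N : nat => N%:R^-1 * occ (aN a N) N i) @ \oo --> (0 : R)) /\
     (forall eta : R, eta < 1 ->
        (fun N : nat => (N%:R `^ eta)^-1 * occ (aN a N) N 1) @ \oo --> +oo)).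
Proof.
split; first exact: cvg_sum_occ.
split=> [a1 i hi|a1]; first exact: cvg_occ_powR.
split=> [i i1|eta e1]; first exact: cvg_occ_pos_level.
exact: cvg_occ1_powR.
Qed.
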